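(* Let $n\ge 3$, let $A_0,A_1,A_2\in\mathbb{R}^{n\times n}$ be symmetric matrices and put $q_i(x)=x^TA_ix$ for $i=0,1,2$. Suppose that - there exist $\mu_1,\mu_2\in\mathbb{R}$ with $\mu_1A_1+\mu_2A_2\succ 0$; - there exists $x^0\in\mathbb{R}^n$ with $q_1(x^0)=1$ and $q_2(x^0)<1$; - there exists $x^1\in\mathbb{R}^n$ with $q_1(x^1)=1$ and $q_2(x^1)>1$. Let $x^*$ be a local minimizer of $$\min_{x\in\mathbb{R}^n}\{q_0(x):\ q_1(x)=1,\ q_2(x)\le 1\}$$ satisfying $q_2(x^* )=1$. If the linear independence constraint qualification (LICQ) fails to hold at $x^*$, then $x^*$ is a global minimizer of this problem.
   Context: $M\succ 0$ means that the symmetric matrix $M$ is positive definite. At a feasible point $x^*$ with $q_2(x^* )=1$, LICQ means that the gradients of the two active constraints are linearly independent, i.e. $A_1x^*$ and $A_2x^*$ are linearly independent. *)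

(* Defs.v *)
From HB Require Import structures.
From mathcomp Require Import all_boot all_order all_algebra.
From mathcomp Require Import all_classical all_reals all_analysis.
Set Implicit Arguments.
Unset Strict Implicit.
Unset Printing Implicit Defensive.
Import Order.TTheory GRing.Theory Num.Theory.
Import numFieldNormedType.Exports.
Local Open Scope classical_set_scope.
Local Open Scope ring_scope.

Definition qform (R : realType) (n : nat) (A : 'M[R]_n) (x : 'cV[R]_n) : R :=
  (x^T *m A *m x) 0 0.

Definition posdef (R : realType) (n : nat) (M : 'M[R]_n) : Prop :=
  M^T = M /\ forall x : 'cV[R]_n, x != 0 -> 0 < qform M x.

Definition gradient (R : realType) (n : nat) (f : 'cV[R]_n -> R)
    (x : 'cV[R]_n) : 'cV[R]_n :=
  \col_i 'D_(delta_mx i 0 : 'cV[R]_n) f x.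

(* LICQ for {x | g x = 1 /\ h x <= 1} at a point where h x = 1, so that both
   constraints are active; for quadratic forms the gradients are 2 A_i x. *)
Definition LICQ_active (R : realType) (n : nat) (g h : 'cV[R]_n -> R)
    (x : 'cV[R]_n) : bool :=
  free [:: gradient g x; gradient h x].

Definition local_minimizer (R : realType) (T : topologicalType) (f : T -> R)
    (S : set T) (x : T) : Prop :=
  S x /\ \forall y \near x, S y -> f x <= f y.

Definition global_minimizer (R : realType) (T : Type) (f : T -> R)
    (S : set T) (x : T) : Prop :=
  S x /\ forall y, S y -> f x <= f y.

(* Main.v *)
Require Import Defs.
From HB Require Import structures.
From mathcomp Require Import all_boot all_order all_algebra.
From mathcomp Require Import all_classical all_reals all_analysis.
From mathcomp Require Import ring lra.
Import Order.TTheory GRing.Theory Num.Theory.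
Import numFieldNormedType.Exports.
Local Open Scope classical_set_scope.
Local Open Scope ring_scope.

(** Why the theorem holds.  Write [B = A2 - A1].  The gradients of the two
constraints at [xs] are [2 A1 xs] and [2 A2 xs]; pairing a linear dependence
between them with [xs], where both forms take the value 1, shows that it can
only be [A1 xs = A2 xs], that is, [B xs = 0].  Hence
[qform B (xs + e y) = e ^ 2 qform B y] for all [y] and [e]: the whole line
through [xs] in a direction [y] of the cone [qform B <= 0] stays in that cone.

Every feasible [y] is such a direction.  Close to [xs] the form [qform A1] is
positive, so the points of this line can be rescaled to feasible points, and
local minimality says that the form [F = qform A0 - qform A0 xs * qform A1],
which vanishes at [xs], is nonnegative at [xs + e y] and at [xs - e y] for
small [e].  By the parallelogram law the sum of these two values is
[2 e ^ 2 F y].  Thus [F y >= 0], which for a feasible [y] reads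
[qform A0 xs <= qform A0 y].

The two halves of the argument are [eq_mulmx_of_not_LICQ] and
[local_minimizer_homogeneous]. *)

Lemma qformZ (R : realType) (n : nat) (A : 'M[R]_n) (k : R) (x : 'cV[R]_n) :
  qform A (k *: x) = k ^+ 2 * qform A x.
Proof.
by rewrite /qform [(k *: x)^T]linearZ /= -!scalemxAl -scalemxAr !mxE expr2 mulrA.
Qed.

Lemma qform_line (R : realType) (n : nat) (A : 'M[R]_n) (x v : 'cV[R]_n)
    (h : R) : A^T = A ->
  qform A (h *: v + x) =
  h ^+ 2 * qform A v + h * (2 * (v^T *m (A *m x)) 0 0) + qform A x.
Proof.
move=> A_sym.
have swap : (x^T *m A *m v) 0 0 = (v^T *m (A *m x)) 0 0.
  transitivity ((x^T *m A *m v)^T 0 0); first by rewrite [RHS]mxE.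
  by rewrite !trmx_mul trmxK A_sym.
rewrite /qform [(_ + _)^T]linearD /= [(h *: v)^T]linearZ /= !mulmxDl !mulmxDr.
rewrite -?(scalemxAl, scalemxAr) -!mulmxA.
move: swap; rewrite -!mulmxA !mxE => ->; ring.
Qed.

Lemma derive_qform (R : realType) (n : nat) (A : 'M[R]_n) (x v : 'cV[R]_n) :
  A^T = A -> 'D_v (qform A) x = 2 * (v^T *m (A *m x)) 0 0.
Proof.
move=> A_sym; rewrite /derive; apply: cvg_lim => //.
set b := 2 * _.
have lim0 : (fun h : R => h * qform A v + b) @ 0^' --> 0 * qform A v + b.
  apply: cvg_within_filter.
  by apply: cvgD; [apply: cvgMr_tmp; exact: cvg_id | exact: cvg_cst].
rewrite mul0r add0r in lim0.
apply: cvg_trans lim0; apply: near_eq_cvg; near=> h.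
have h0 : h != 0 by near: h; exact: nbhs_dnbhs_neq.
rewrite /= qform_line// -/b addrK /GRing.scale /=.
by field.
Unshelve. all: by end_near. Qed.

Lemma gradient_qform (R : realType) (n : nat) (A : 'M[R]_n) (x : 'cV[R]_n) :
  A^T = A -> gradient (qform A) x = 2 *: (A *m x).
Proof.
move=> A_sym; apply/matrixP => i j; rewrite ord1 mxE derive_qform//.
by rewrite trmx_delta -rowE !mxE.
Qed.

(** The dependence is normalized by pairing it with [x]: both [A x] and [B x]
pair to 1 with [x], so neither vanishes and their ratio is 1. *)
Lemma eq_mulmx_of_not_LICQ (R : realType) (n : nat) (A B : 'M[R]_n)
    (x : 'cV[R]_n) : A^T = A -> B^T = B -> qform A x = 1 -> qform B x = 1 ->
  ~~ LICQ_active (qform A) (qform B) x -> A *m x = B *m x.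
Proof.
move=> A_sym B_sym Ax Bx.
rewrite /LICQ_active !gradient_qform// free_cons seq1_free span_seq1.
rewrite negb_and !negbK => /orP[/vlineP[k]|/eqP].
  rewrite scalerA mulrC -scalerA => AkB2.
  have {AkB2} AkB : A *m x = k *: (B *m x).
    by apply: (scalerI _ AkB2); rewrite pnatr_eq0.
  have k1 : 1 = k.
    by rewrite -Ax /qform -mulmxA AkB -scalemxAr mulmxA mxE -/(qform B x) Bx mulr1.
  by rewrite AkB -k1 scale1r.
move/eqP; rewrite scaler_eq0 pnatr_eq0 /= => /eqP Bx0.
by move: Bx; rewrite /qform -mulmxA Bx0 mulmx0 mxE => /esym/eqP; rewrite oner_eq0.
Qed.

(** Rescaling to [qform A = 1] turns local minimality on a slice of the cone
[qform B <= qform A] into a homogeneous inequality on the cone itself, along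
each line through [x] that does not leave it. *)
Lemma local_minimizer_homogeneous (R : realType) (n : nat)
    (C A B : 'M[R]_n) (x v : 'cV[R]_n) : A^T = A -> qform A x = 1 ->
  local_minimizer (qform C)
    [set y | qform A y = 1 /\ qform B y <= 1] x ->
  (forall e : R, qform B (e *: v + x) <= qform A (e *: v + x)) ->
  \forall e \near (0 : R),
    qform C x * qform A (e *: v + x) <= qform C (e *: v + x).
Proof.
move=> A_sym Ax [_ x_min] cone.
have line_cvg : (fun e : R => e *: v + x) @ 0 --> 0 *: v + x.
  by apply: cvgD; [apply: cvgZr_tmp; exact: cvg_id | exact: cvg_cst].
rewrite scale0r add0r in line_cvg.
pose b := 2 * (v^T *m (A *m x)) 0 0.
have A_cvg : (fun e : R => qform A (e *: v + x)) @ 0 -->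
    (0 * 0) * qform A v + 0 * b + 1.
  under eq_fun do rewrite qform_line// Ax -/b expr2.
  apply: cvgD; last exact: cvg_cst.
  apply: cvgD; apply: cvgMr_tmp; last exact: cvg_id.
  by apply: cvgM; exact: cvg_id.
rewrite !mul0r !add0r in A_cvg.
pose s e := Num.sqrt (qform A (e *: v + x)).
have s_cvg : s @ 0 --> Num.sqrt 1.
  exact: (continuous_cvg _ (@sqrt_continuous R 1) A_cvg).
rewrite sqrtr1 in s_cvg.
have normalized_cvg : (fun e : R => (s e)^-1 *: (e *: v + x)) @ 0 -->
    1^-1 *: x.
  by apply: cvgZ line_cvg; apply: cvgV s_cvg; exact: oner_neq0.
rewrite invr1 scale1r in normalized_cvg.
have A_gt0 : \forall e \near (0 : R), 0 < qform A (e *: v + x).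
  exact: (cvgr_gt _ A_cvg _ ltr01).
near=> e.
have q_gt0 : 0 < qform A (e *: v + x) by near: e.
have scaled (D : 'M[R]_n) : qform D ((s e)^-1 *: (e *: v + x)) =
    qform D (e *: v + x) / qform A (e *: v + x).
  by rewrite qformZ exprVn sqr_sqrtr ?ltW// mulrC.
rewrite -ler_pdivlMr// -scaled.
have : [set y | qform A y = 1 /\ qform B y <= 1] ((s e)^-1 *: (e *: v + x)).
  by rewrite /= !scaled divff ?gt_eqF// ler_pdivrMr// mul1r.
by near: e; exact: (normalized_cvg _ x_min).
Unshelve. all: by end_near. Qed.

Theorem theorem3p8 (R : realType) (n : nat) (hn : (3 <= n)%N)
    (A0 A1 A2 : 'M[R]_n)
    (A0_sym : A0^T = A0) (A1_sym : A1^T = A1) (A2_sym : A2^T = A2)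
    (pencil_pd : exists mu1 mu2 : R, posdef (mu1 *: A1 + mu2 *: A2))
    (slater_lt : exists x0 : 'cV[R]_n, qform A1 x0 = 1 /\ qform A2 x0 < 1)
    (slater_gt : exists x1 : 'cV[R]_n, qform A1 x1 = 1 /\ qform A2 x1 > 1)
    (xs : 'cV[R]_n)
    (xs_local : local_minimizer (qform A0)
       [set x : 'cV[R]_n | qform A1 x = 1 /\ qform A2 x <= 1] xs)
    (xs_active : qform A2 xs = 1)
    (no_LICQ : ~~ LICQ_active (qform A1) (qform A2) xs) :
  global_minimizer (qform A0)
    [set x : 'cV[R]_n | qform A1 x = 1 /\ qform A2 x <= 1] xs.
Proof.
have [[q1s _] _] := xs_local.
have same := eq_mulmx_of_not_LICQ _ _ _ _ _ A1_sym A2_sym q1s xs_active no_LICQ.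
split=> [|y [q1y q2y]]; first by rewrite /= xs_active.
have cone (e : R) : qform A2 (e *: y + xs) <= qform A1 (e *: y + xs).
  rewrite !qform_line// same q1s xs_active q1y !lerD2r.
  by rewrite ler_wpM2l// sqr_ge0.
have := local_minimizer_homogeneous _ _ _ _ _ _ _ A1_sym q1s xs_local cone.
move=> /nbhs_ballP[d /= d_gt0 F_ge0].
have d2_gt0 : 0 < d / 2 by rewrite divr_gt0.
have d2_lt : d / 2 < d by lra.
(* Opposite steps cancel the linear term of the form along the line. *)
have := F_ge0 (d / 2); have := F_ge0 (- (d / 2)).
rewrite /ball /= !sub0r opprK normrN gtr0_norm// => /(_ d2_lt) + /(_ d2_lt).
rewrite !qform_line// q1s q1y sqrrN => Fm Fp.
have : 0 <= (d / 2) ^+ 2 * (qform A0 y - qform A0 xs).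
  lra.
by rewrite pmulr_rge0 ?exprn_gt0// subr_ge0.
Qed.
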